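(* The theory $\lambda_{\beta\eta\mathrm{SP}}$ is consistent.
   Context: The $\lambda$-terms (with pairing and projections) are given by the grammar $M ::= x \mid \lambda x.M \mid M\,M \mid \langle M,M\rangle \mid \pi_1 M \mid \pi_2 M$, where $x$ ranges over an infinite set of variables; $\alpha$-equivalent terms are identified. $\mathrm{FV}(M)$ is the set of free variables of $M$, and $M[x:=N]$ is capture-avoiding substitution. The relation $=_{\beta\eta\mathrm{SP}}$ is the reflexive-transitive-symmetric closure of the compatible closure (closure under all term constructors, i.e. under $\lambda x.[\,]$, both argument positions of application and of pairing, $\pi_1$ and $\pi_2$) on $\lambda$-terms of the following axioms: - $(\beta)$ $(\lambda x.M)\,N \rhd M[x:=N]$; - $(\eta)$ $\lambda x.M\,x \rhd M$ if $x\notin \mathrm{FV}(M)$; - $(\pi_1)$ $\pi_1\langle M,N\rangle \rhd M$; - $(\pi_2)$ $\pi_2\langle M,N\rangle \rhd N$; - $(\mathrm{SP})$ $\langle \pi_1 M,\pi_2 M\rangle \rhd M$. The theory $\lambda_{\beta\eta\mathrm{SP}}$ is the set of formal equations ''$M=N$'' between $\lambda$-terms such that $M =_{\beta\eta\mathrm{SP}} N$. A theory is consistent if it does not contain every equation between $\lambda$-terms. *)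

(* Defs.v *)
(* Plain Stdlib development. *)
From Stdlib Require Import Relations.

(* Lambda-terms with pairing and projections up to alpha-equivalence, in de
   Bruijn notation: [Var n] under [k] binders is bound when [n < k], and
   otherwise is the free variable number [n - k]; the free variables are thus
   indexed by nat. *)
Inductive term : Type :=
| Var (n : nat)
| Lam (M : term)
| App (M N : term)
| Pair (M N : term)
| Proj1 (M : term)
| Proj2 (M : term).

Definition up_ren (r : nat -> nat) (n : nat) : nat :=
  match n with
  | O => O
  | S m => S (r m)
  end.

Fixpoint rename (r : nat -> nat) (M : term) : term :=
  match M with
  | Var n => Var (r n)
  | Lam M => Lam (rename (up_ren r) M)
  | App M N => App (rename r M) (rename r N)
  | Pair M N => Pair (rename r M) (rename r N)
  | Proj1 M => Proj1 (rename r M)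
  | Proj2 M => Proj2 (rename r M)
  end.

Definition up_subst (s : nat -> term) (n : nat) : term :=
  match n with
  | O => Var O
  | S m => rename S (s m)
  end.

(* Simultaneous capture-avoiding substitution. *)
Fixpoint subst (s : nat -> term) (M : term) : term :=
  match M with
  | Var n => s n
  | Lam M => Lam (subst (up_subst s) M)
  | App M N => App (subst s M) (subst s N)
  | Pair M N => Pair (subst s M) (subst s N)
  | Proj1 M => Proj1 (subst s M)
  | Proj2 M => Proj2 (subst s M)
  end.

(* M[x:=N], where x is the variable bound by the abstraction [Lam M]: index 0
   is replaced by N and the remaining indices are decremented. *)
Definition subst1 (M N : term) : term :=
  subst (fun n => match n with O => N | S m => Var m end) M.

Inductive axiom : term -> term -> Prop :=
| ax_beta M N : axiom (App (Lam M) N) (subst1 M N)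
(* The terms [rename S M] are exactly those in which index 0, the variable
   bound by the abstraction, is not free; this is the side condition of eta. *)
| ax_eta M : axiom (Lam (App (rename S M) (Var 0))) M
| ax_pi1 M N : axiom (Proj1 (Pair M N)) M
| ax_pi2 M N : axiom (Proj2 (Pair M N)) N
| ax_SP M : axiom (Pair (Proj1 M) (Proj2 M)) M.

Inductive compat_closure (R : relation term) : relation term :=
| cc_base M N : R M N -> compat_closure R M N
| cc_Lam M M' :
    compat_closure R M M' -> compat_closure R (Lam M) (Lam M')
| cc_App_l M M' N :
    compat_closure R M M' -> compat_closure R (App M N) (App M' N)
| cc_App_r M N N' :
    compat_closure R N N' -> compat_closure R (App M N) (App M N')
| cc_Pair_l M M' N :
    compat_closure R M M' -> compat_closure R (Pair M N) (Pair M' N)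
| cc_Pair_r M N N' :
    compat_closure R N N' -> compat_closure R (Pair M N) (Pair M N')
| cc_Proj1 M M' :
    compat_closure R M M' -> compat_closure R (Proj1 M) (Proj1 M')
| cc_Proj2 M M' :
    compat_closure R M M' -> compat_closure R (Proj2 M) (Proj2 M').

Definition eq_beta_eta_SP : relation term :=
  clos_refl_sym_trans term (compat_closure axiom).

(* The pair (M, N) stands for the formal equation "M = N". *)
Definition equation : Type := (term * term)%type.
Definition theory : Type := equation -> Prop.

Definition lambda_beta_eta_SP : theory :=
  fun e => eq_beta_eta_SP (fst e) (snd e).

Definition consistent (T : theory) : Prop := ~ forall e : equation, T e.

(* Main.v *)
From mathcomp Require Import all_boot zify.
Require Import Defs.

(** The theory has a model in which the variables [Var 0] and [Var 1] differ,
    namely an extensional reflexive object of the relational (finite multiset)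
    semantics of linear logic; equivalently, terms are interpreted by a
    non-idempotent intersection type system.

    In that semantics a type is a bare set, the product of two sets is their
    disjoint union, and the exponential of [D] by itself is the set of pairs
    (finite multiset over [D], element of [D]).  A model of beta, eta, the
    projections and surjective pairing therefore only needs a set [D] in
    bijection with both [D + D] and [Mfin D * D], and every countably infinite
    set is one.  Here [D] is [nat]: parity gives the first bijection, and
    [arr] gives the second, a multiset being presented by any list of its
    elements.

    A term denotes a set of judgements (value, context), where a context lists
    the resources consumed: the pair [(n, d)] is one use of variable [n] at
    value [d].  Contexts matter only up to permutation.  An application splits
    its context between the function and as many copies of the argument as the
    function uses; no weakening or contraction is available, and this exact
    bookkeeping is what makes eta an equality.  Substitution is interpreted by
    the Kleisli composition [comp], and the model validates
    - beta by the substitution lemma [den_subst];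
    - eta by surjectivity of [arr], the only use of variable 0 in
      [App (rename S M) (Var 0)] being that of the argument;
    - the projection rules and surjective pairing by the parity bijection.

    Finally [Var 0] and [Var 1] consume different resources. *)

(** * The two bijections *)

Definition gaps (s : seq nat) : seq nat := pairmap (fun x y => y - x) 0 s.

(** Sorting picks a canonical representative of the multiset listed by [m];
    taking successive differences turns sorted lists into arbitrary lists, so
    that pairs (multiset, value) become exactly the nonempty lists of naturals;
    these are in bijection with the positive naturals, whence the predecessor. *)
Definition arr (m : seq nat) (a : nat) : nat :=
  (CodeSeq.code (a :: gaps (sort leq m))).-1.

Lemma gapsK s : sorted leq s -> scanl addn 0 (gaps s) = s.
Proof.
rewrite /gaps => sorted_s.
have: path leq 0 s by case: s sorted_s.
elim: s 0 {sorted_s} => //= y s IHs x /andP[le_xy path_s].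
by rewrite subnKC // IHs.
Qed.

Lemma scanl_addn_sorted s : sorted leq (scanl addn 0 s).
Proof.
apply: (@path_sorted _ _ 0).
by elim: s 0 => //= y s IHs x; rewrite leq_addr IHs.
Qed.

Lemma code_cons_gt0 a s : 0 < CodeSeq.code (a :: s).
Proof. by rewrite /= muln_gt0 expn_gt0. Qed.

Lemma eq_arr {m m' a} : perm_eq m m' -> arr m a = arr m' a.
Proof.
by move/(perm_sortP leq_total leq_trans anti_leq) => eq_mm'; rewrite /arr eq_mm'.
Qed.

Lemma arr_inj m m' a a' : arr m a = arr m' a' -> perm_eq m m' /\ a = a'.
Proof.
rewrite /arr => /(congr1 succn); rewrite !prednK ?code_cons_gt0 //.
move/(can_inj CodeSeq.codeK) => [-> /(congr1 (scanl addn 0))].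
rewrite !gapsK ?(sort_sorted leq_total) // => eq_mm'.
by split=> //; apply/(perm_sortP leq_total leq_trans anti_leq).
Qed.

Lemma arr_surj c : exists m a, c = arr m a.
Proof.
have := CodeSeq.decodeK c.+1.
case: (CodeSeq.decode c.+1) => [|a g] // code_ag.
exists (scanl addn 0 g), a.
rewrite /arr /gaps (sorted_sort leq_trans) ?scanl_addn_sorted //.
by rewrite scanlK ?code_ag // => x y; rewrite addKn.
Qed.

(** * Splitting resources over a list *)

(* A permutation between concatenations holds when every predicate has the same
   number of occurrences on both sides, which is linear arithmetic. *)
Ltac permutation :=
  let p := fresh "p" in
  apply/permP => p;
  repeat match goal with H : is_true (perm_eq _ _) |- _ =>
    move/permP/(_ p): H end;
  rewrite ?count_cat /=; lia.

(** The promotion of [R] to multisets: each entry of [l] receives a share of [G]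
    of its own, so that nothing is duplicated or discarded. *)
Fixpoint splits {T : Type} {U : eqType} (R : T -> seq U -> Prop) (l : seq T) :
    seq U -> Prop :=
  if l is t :: l' then
    fun G => exists G1 G2, [/\ perm_eq G (G1 ++ G2), R t G1 & splits R l' G2]
  else fun G => G = [::].

Lemma splits_perm {T} {U : eqType} (R : T -> seq U -> Prop) l G G' :
  perm_eq G G' -> splits R l G -> splits R l G'.
Proof.
case: l => [|t l] /= permG.
  by move=> defG; move: permG; rewrite defG perm_sym => /perm_nilP.
by move=> [G1 [G2 [permG' ? ?]]]; exists G1, G2; split=> //; permutation.
Qed.

Lemma splits_cat {T} {U : eqType} (R : T -> seq U -> Prop) l1 l2 G :
  splits R (l1 ++ l2) G <->
  exists G1 G2, [/\ perm_eq G (G1 ++ G2), splits R l1 G1 & splits R l2 G2].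
Proof.
elim: l1 G => [|t l1 IHl] G /=.
  split=> [splitG | [G1 [G2 [permG defG1 splitG2]]]]; first by exists [::], G.
  by apply: splits_perm splitG2; rewrite perm_sym -[G2]cat0s -defG1.
split=> [[G1 [G2 [permG Rt /IHl[G3 [G4 [permG2 ? ?]]]]]] |].
  exists (G1 ++ G3), G4; split=> //; first by permutation.
  by exists G1, G3.
move=> [G5 [G4 [permG [G1 [G3 [permG' Rt ?]]] ?]]].
exists G1, (G3 ++ G4); split=> //; first by permutation.
by apply/IHl; exists G3, G4.
Qed.

Lemma splits_perml {T U : eqType} {R : T -> seq U -> Prop} {l l' G} :
  perm_eq l l' -> splits R l G -> splits R l' G.
Proof.
move=> perm_ll'; move: l l' perm_ll'.
apply: catCA_perm_ind => l1 l2 l3.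
move=> /splits_cat[G1 [G' [permG ? /splits_cat[G2 [G3 [permG' ? ?]]]]]].
apply/splits_cat; exists G2, (G1 ++ G3); split=> //; first by permutation.
by apply/splits_cat; exists G1, G3.
Qed.

Lemma splits_map {T T'} {U : eqType} (R : T' -> seq U -> Prop) (f : T -> T') l G :
  splits R (map f l) G <-> splits (fun t => R (f t)) l G.
Proof.
suff -> : splits R (map f l) = splits (fun t => R (f t)) l by [].
by elim: l => //= t l ->.
Qed.

Lemma splits_ext {T} {U : eqType} {R R' : T -> seq U -> Prop} {l G} :
  (forall t G, R t G <-> R' t G) -> splits R l G <-> splits R' l G.
Proof.
move=> eqR; elim: l G => [|t l IHl] G //=.
by split=> -[G1 [G2 [permG /eqR ? /IHl ?]]]; exists G1, G2.
Qed.

(** Associativity of Kleisli composition: the entries of [l] can be split into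
    intermediate resources all at once, and these into elements of [G]. *)
Lemma splits_bind {T} {V U : eqType} (R : T -> seq V -> Prop)
    (Q : V -> seq U -> Prop) l G :
  splits (fun t G => exists D, R t D /\ splits Q D G) l G <->
  exists D, splits R l D /\ splits Q D G.
Proof.
elim: l G => [|t l IHl] G /=.
  by split=> [-> | [D [-> //]]]; exists [::].
split.
  move=> [G1 [G2 [permG [D1 [RD1 QD1]] /IHl[D2 [RD2 QD2]]]]].
  exists (D1 ++ D2); split; first by exists D1, D2.
  by apply/splits_cat; exists G1, G2.
move=> [D [[D1 [D2 [permD RD1 RD2]]] /(splits_perml permD)]].
move=> /splits_cat[G1 [G2 [permG QD1 QD2]]].
exists G1, G2; split=> //; first by exists D1.
by apply/IHl; exists D2.
Qed.

Lemma splits_seq1 {T} {U : eqType} (f : T -> U) l G :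
  splits (fun t G => perm_eq G [:: f t]) l G <-> perm_eq G (map f l).
Proof.
elim: l G => [|t l IHl] G /=.
  by split=> [-> // | /perm_nilP].
split=> [[G1 [G2 [permG permG1 /IHl permG2]]] | permG].
  by rewrite -cat1s; permutation.
by exists [:: f t], (map f l); split=> //; apply/IHl.
Qed.

Lemma splits_map_out {T} {V U : eqType} (R : T -> seq V -> Prop) (f : V -> U) l G :
  splits (fun t G => exists G', R t G' /\ perm_eq G (map f G')) l G <->
  exists G', splits R l G' /\ perm_eq G (map f G').
Proof.
transitivity (exists G', splits R l G' /\
    splits (fun v G => perm_eq G [:: f v]) G' G).
  rewrite -splits_bind; apply: splits_ext => t G1.
  by split=> -[G' [? /splits_seq1 ?]]; exists G'.
by split=> -[G' [? /splits_seq1 ?]]; exists G'.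
Qed.

(** * The model *)

Definition context : Type := seq (nat * nat).
Definition denotation : Type := nat -> context -> Prop.

Definition eqd (A B : denotation) : Prop := forall a G, A a G <-> B a G.

Definition shift (t : nat * nat) : nat * nat := (t.1.+1, t.2).

(** The context [G] under a binder, extended by the multiset [m] of uses of the
    bound variable. *)
Definition extend (m : seq nat) (G : context) : context :=
  map (pair 0) m ++ map shift G.

Definition var_d (n : nat) : denotation := fun a G => perm_eq G [:: (n, a)].

Definition lam_d (A : denotation) : denotation :=
  fun c G => exists m a, c = arr m a /\ A a (extend m G).

Definition app_d (A B : denotation) : denotation :=
  fun b G => exists m G1 G2,
    [/\ perm_eq G (G1 ++ G2), A (arr m b) G1 & splits B m G2].

Definition pair_d (A B : denotation) : denotation :=
  fun c G => if odd c then B c./2 G else A c./2 G.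

Definition proj1_d (A : denotation) : denotation := fun a G => A a.*2 G.

Definition proj2_d (A : denotation) : denotation := fun a G => A a.*2.+1 G.

Fixpoint den (M : term) : denotation :=
  match M with
  | Var n => var_d n
  | Lam M => lam_d (den M)
  | App M N => app_d (den M) (den N)
  | Pair M N => pair_d (den M) (den N)
  | Proj1 M => proj1_d (den M)
  | Proj2 M => proj2_d (den M)
  end.

Lemma extend_surj D : exists m G, perm_eq D (extend m G).
Proof.
elim: D => [|[[|n] d] D [m [G permD]]]; first by exists [::], [::].
  by exists (d :: m), G; rewrite /= perm_cons.
exists m, ((n, d) :: G); rewrite /extend /= -cat1s.
rewrite -(cat1s (shift (n, d))); rewrite /extend in permD; permutation.
Qed.

(** Both components are recovered by counting the uses of variable 0 and those
    of the others. *)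
Lemma extend_inj m m' G G' :
  perm_eq (extend m G) (extend m' G') -> perm_eq m m' /\ perm_eq G G'.
Proof.
move/permP=> countE; split; apply/permP=> p.
  have := countE (fun t => (t.1 == 0) && p t.2).
  rewrite !count_cat !count_map.
  have noshift: preim shift (fun t => (t.1 == 0) && p t.2) =1 pred0 by [].
  by rewrite !(eq_count noshift) !count_pred0 !addn0.
have := countE (fun t => (t.1 != 0) && p (t.1.-1, t.2)).
rewrite !count_cat !count_map.
set q := (fun t => _ && _).
have noinj: preim (pair 0) q =1 pred0 by [].
have shiftE: preim shift q =1 p by case.
by rewrite !(eq_count noinj) !(eq_count shiftE) !count_pred0.
Qed.

Lemma perm_extend m m' G G' :
  perm_eq m m' -> perm_eq G G' -> perm_eq (extend m G) (extend m' G').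
Proof. by move=> permm permG; apply: perm_cat; apply: perm_map. Qed.

(** A context stands for a multiset of resources; this is independence of the
    order in which they are listed. *)
Definition saturated (A : denotation) : Prop :=
  forall a G G', perm_eq G G' -> A a G -> A a G'.

Lemma den_perm M : saturated (den M).
Proof.
elim: M => [n|M IHM|M IHM N IHN|M IHM N IHN|M IHM|M IHM] a G G' permG /=.
- by rewrite /var_d; apply: perm_trans; rewrite perm_sym.
- move=> [m [b [-> MG]]]; exists m, b; split=> //.
  by apply: IHM MG; apply: perm_extend.
- move=> [m [G1 [G2 [permG' ? ?]]]]; exists m, G1, G2; split=> //.
  by permutation.
- by rewrite /pair_d; case: ifP => _; [apply: IHN | apply: IHM].
- exact: IHM.
- exact: IHM.
Qed.

(** * Substitution *)

(** Substitution of the denotations [s n] for the variables [n] of [A]. *)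
Definition comp (A : denotation) (s : nat -> denotation) : denotation :=
  fun a G => exists D, A a D /\ splits (fun t => s t.1 t.2) D G.

Definition up_d (s : nat -> denotation) (n : nat) : denotation :=
  if n is n'.+1 then fun a G => exists G', s n' a G' /\ perm_eq G (map shift G')
  else var_d 0.

Lemma splits_up_extend s m D G :
  splits (fun t => up_d s t.1 t.2) (extend m D) G <->
  exists G', splits (fun t => s t.1 t.2) D G' /\ perm_eq G (extend m G').
Proof.
rewrite splits_cat; split.
  move=> [G1 [G2 [permG /splits_map sm /splits_map/splits_map_out]]].
  move=> [G' [sG' permG2]]; exists G'; split=> //.
  have permG1: perm_eq G1 (map (pair 0) m) by apply/splits_seq1.
  by rewrite /extend; permutation.
move=> [G' [sG' permG]]; exists (map (pair 0) m), (map shift G'); split=> //.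
  by apply/splits_map/splits_seq1.
by apply/splits_map/splits_map_out; exists G'.
Qed.

Lemma comp_var n s : saturated (s n) -> eqd (comp (var_d n) s) (s n).
Proof.
move=> sat_s a G; split.
  move=> [D [permD /(splits_perml permD)[G1 [G2 [permG sG1 defG2]]]]].
  by apply: sat_s sG1; rewrite perm_sym -[G1]cats0 -defG2.
move=> sG; exists [:: (n, a)]; split; first exact: perm_refl.
by exists G, [::]; rewrite cats0.
Qed.

(** Every context of [A] splits into uses of the bound variable, which
    [up_d s] leaves alone, and shifted uses of the others, on which it acts
    as [s]. *)
Lemma comp_lam {A s} :
  saturated A -> eqd (comp (lam_d A) s) (lam_d (comp A (up_d s))).
Proof.
move=> satA c G; split.
  move=> [D [[m [a [-> AD]]] sD]]; exists m, a; split=> //.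
  by exists (extend m D); split=> //; apply/splits_up_extend; exists G.
move=> [m [a [-> [D' [AD' sD']]]]].
have [m' [D permD']] := extend_surj D'.
have /splits_up_extend[G' [sD /extend_inj[permm permG]]] :=
  splits_perml permD' sD'.
exists D; split; last by apply: splits_perm sD; rewrite perm_sym.
exists m', a; split; first exact: eq_arr.
exact: satA permD' AD'.
Qed.

(** The context of an application of [A] to [B] is divided between [A] and the
    copies of [B], and so is what [s] substitutes for it; for the copies this
    is the associativity [splits_bind]. *)
Lemma comp_app {A B s} :
  eqd (comp (app_d A B) s) (app_d (comp A s) (comp B s)).
Proof.
move=> b G; split.
  move=> [D [[m [D1 [D2 [permD AD1 BD2]]]] /(splits_perml permD)]].
  move=> /splits_cat[G1 [G2 [permG sD1 sD2]]].
  exists m, G1, G2; split=> //; first by exists D1.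
  by apply/splits_bind; exists D2.
move=> [m [G1 [G2 [permG [D1 [AD1 sD1]] /splits_bind[D2 [BD2 sD2]]]]]].
exists (D1 ++ D2); split; first by exists m, D1, D2.
by apply/splits_cat; exists G1, G2.
Qed.

Lemma comp_pair {A B s} :
  eqd (comp (pair_d A B) s) (pair_d (comp A s) (comp B s)).
Proof. by move=> c G; rewrite /comp /pair_d; case: odd. Qed.

Lemma lam_ext A B : eqd A B -> eqd (lam_d A) (lam_d B).
Proof.
by move=> eqAB c G; split=> -[m [a [-> /eqAB ?]]]; exists m, a.
Qed.

Lemma app_ext A A' B B' :
  eqd A A' -> eqd B B' -> eqd (app_d A B) (app_d A' B').
Proof.
move=> eqA eqB b G.
split=> -[m [G1 [G2 [permG /eqA AG1 /(splits_ext eqB) BG2]]]];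
by exists m, G1, G2.
Qed.

Lemma pair_ext A A' B B' :
  eqd A A' -> eqd B B' -> eqd (pair_d A B) (pair_d A' B').
Proof. by move=> eqA eqB c G; rewrite /pair_d; case: odd. Qed.

Lemma comp_ext A s s' :
  (forall n, eqd (s n) (s' n)) -> eqd (comp A s) (comp A s').
Proof.
move=> eqs a G.
have eq_splits D := splits_ext (l := D) (G := G) (fun t => eqs t.1 t.2).
by split=> -[D [AD /eq_splits sD]]; exists D.
Qed.

Lemma eqd_trans A B C : eqd A B -> eqd B C -> eqd A C.
Proof. by move=> eqAB eqBC a G; rewrite eqAB. Qed.

Lemma eqd_sym {A B} : eqd A B -> eqd B A.
Proof. by move=> eqAB a G; rewrite eqAB. Qed.

(** The special case of [den_subst] that its own induction requires, because
    [up_subst] renames the substituted terms when it passes under a binder. *)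
Lemma den_rename r M :
  eqd (den (rename r M)) (comp (den M) (fun n => var_d (r n))).
Proof.
elim: M r => [n|M IHM|M IHM N IHN|M IHM N IHN|M IHM|M IHM] r /=.
- by apply: eqd_sym; apply: comp_var; apply: (den_perm (Var (r n))).
- apply: eqd_trans (eqd_sym (comp_lam (den_perm M))).
  apply: lam_ext; apply: eqd_trans (IHM _) _; apply: comp_ext => -[|n] //= a G.
  split=> [permG | [G' [permG' permG]]].
    by exists [:: (r n, a)]; split=> //; apply: perm_refl.
  by apply: perm_trans permG _; apply: (perm_map shift permG').
- by apply: eqd_trans (eqd_sym comp_app); apply: app_ext.
- by apply: eqd_trans (eqd_sym comp_pair); apply: pair_ext.
- by move=> a G; apply: IHM.
- by move=> a G; apply: IHM.
Qed.

Lemma den_rename_S M a G :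
  den (rename S M) a G <-> exists G', den M a G' /\ perm_eq G (map shift G').
Proof.
rewrite den_rename.
by split=> -[D [MD /splits_seq1 ?]]; exists D.
Qed.

Lemma den_subst s M : eqd (den (subst s M)) (comp (den M) (fun n => den (s n))).
Proof.
elim: M s => [n|M IHM|M IHM N IHN|M IHM N IHN|M IHM|M IHM] s /=.
- by apply: eqd_sym; apply: comp_var; apply: den_perm.
- apply: eqd_trans (eqd_sym (comp_lam (den_perm M))).
  apply: lam_ext; apply: eqd_trans (IHM _) _; apply: comp_ext => -[|n] //= a G.
  exact: den_rename_S.
- by apply: eqd_trans (eqd_sym comp_app); apply: app_ext.
- by apply: eqd_trans (eqd_sym comp_pair); apply: pair_ext.
- by move=> a G; apply: IHM.
- by move=> a G; apply: IHM.
Qed.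

(** * Soundness and consistency *)

(** Injectivity of [arr] turns the existential of [lam_d] into a rule that can
    be inverted. *)
Lemma lam_arr M m a G :
  lam_d (den M) (arr m a) G <-> den M a (extend m G).
Proof.
split=> [[m' [a' [/arr_inj[permm <-]]]] | ?]; last by exists m, a.
by apply: den_perm; apply: perm_extend; rewrite // perm_sym.
Qed.

(** The substitution lemma feeds to each use of the bound variable its own
    derivation for [N], and leaves the other resources unchanged: this is the
    splitting that an application prescribes. *)
Lemma den_beta M N : eqd (den (App (Lam M) N)) (den (subst1 M N)).
Proof.
move=> b G; rewrite /subst1 den_subst /=; split.
  move=> [m [G1 [G2 [permG /lam_arr MG1 NG2]]]].
  exists (extend m G1); split=> //; apply/splits_cat; exists G2, G1; split.
  - by permutation.
  - exact/splits_map.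
  - apply/splits_map/splits_seq1; rewrite (_ : map _ _ = G1) //.
    by rewrite -[RHS]map_id; apply: eq_map; case.
move=> [D [MD sD]]; have [m [G1 permD]] := extend_surj D.
have := splits_perml permD sD.
move=> /splits_cat[G2 [G3 [permG /splits_map NG2 /splits_map/splits_seq1 permG3]]].
exists m, G1, G2; split=> //; last first.
  by apply/lam_arr; apply: den_perm permD MD.
have idG1: map (fun t : nat * nat => (t.1, t.2)) G1 = G1.
  by rewrite -[RHS]map_id; apply: eq_map; case.
by move: permG3; rewrite /= idG1 => permG3; permutation.
Qed.

(** Variable 0 is absent from the shifted context of [M], so its uses under the
    binder are exactly those made by the argument [Var 0]: the multiset that
    the abstraction binds is the one that [M] expects, by [extend_inj].  That
    every value of [M] is of the form [arr m a] gives the other inclusion. *)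
Lemma den_eta M : eqd (den (Lam (App (rename S M) (Var 0)))) (den M).
Proof.
move=> c G /=; split.
  move=> [m [a [-> [m' [G1 [G2 [permG /den_rename_S[G' [MG' permG1]]]]]]]]].
  move=> /splits_seq1 permG2.
  have [permm permGG'] : perm_eq m m' /\ perm_eq G G'.
    by apply: extend_inj; rewrite /extend in permG *; permutation.
  by rewrite (eq_arr permm); apply: den_perm MG'; rewrite perm_sym.
have [m [a ->]] := arr_surj c => MG; exists m, a; split=> //.
exists m, (map shift G), (map (pair 0) m); split.
- by rewrite /extend; permutation.
- by apply/den_rename_S; exists G.
- exact/splits_seq1.
Qed.

Lemma den_axiom M N : axiom M N -> eqd (den M) (den N).
Proof.
case=> {M N} [M N|M|M N|M N|M].
- exact: den_beta.
- exact: den_eta.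
- by move=> a G /=; rewrite /proj1_d /pair_d odd_double doubleK.
- by move=> a G /=; rewrite /proj2_d /pair_d oddS odd_double /= uphalf_double.
- move=> c G /=; rewrite /pair_d /proj1_d /proj2_d.
  by rewrite -[in den M c](odd_double_half c); case: odd.
Qed.

Lemma den_compat M N : compat_closure axiom M N -> eqd (den M) (den N).
Proof.
elim=> {M N} [M N /den_axiom //|M M' _ eqM|M M' N _ eqM|M N N' _ eqN
  |M M' N _ eqM|M N N' _ eqN|M M' _ eqM|M M' _ eqM] /=.
- exact: lam_ext.
- exact: app_ext.
- exact: app_ext.
- exact: pair_ext.
- exact: pair_ext.
- by move=> a G; apply: eqM.
- by move=> a G; apply: eqM.
Qed.

Lemma den_sound M N : eq_beta_eta_SP M N -> eqd (den M) (den N).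
Proof.
elim=> {M N} [M N /den_compat //|M //|M N _|M N P _ eqMN _ eqNP].
- exact: eqd_sym.
- exact: eqd_trans eqMN eqNP.
Qed.

Theorem corollary5p8 : consistent lambda_beta_eta_SP.
Proof.
move=> /(_ (Var 0, Var 1))/den_sound/(_ 0 [:: (0, 0)])[+ _] => /=.
by move=> /(_ (perm_refl _)).
Qed.
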